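(* Let $\mu$ be a singular strong limit cardinal such that $2^\mu>\mu^+$. Then $$\Big({\mu^+ \atop \mu}\Big) \longrightarrow \Big({\mu+1\atop \mu}\Big)^{1,1}_{<\mathrm{cf}\,\mu},$$ that is: for every cardinal $\theta<\mathrm{cf}\,\mu$ and every function $c:\mu^+\times\mu\to\theta$, there exist sets $A\subseteq\mu^+$ with order type $\mathrm{otp}\,A=\mu+1$ and $B\subseteq\mu$ with order type $\mathrm{otp}\,B=\mu$ such that $c$ is constant on $A\times B$.
   Context: $\mu^+$ denotes the cardinal successor of $\mu$, $\mathrm{cf}\,\mu$ the cofinality of $\mu$, and $\mathrm{otp}\,X$ the order type of a set of ordinals $X$. A cardinal $\mu$ is a strong limit if $2^\nu<\mu$ for all cardinals $\nu<\mu$. The notation $\Big({\mu^+ \atop \mu}\Big) \longrightarrow \Big({\mu+1\atop \mu}\Big)^{1,1}_{<\mathrm{cf}\,\mu}$ means exactly the statement given in the claim: every coloring of $\mu^+\times\mu$ with fewer than $\mathrm{cf}\,\mu$ colors admits $A\subseteq\mu^+$ of order type $\mu+1$ and $B\subseteq\mu$ of order type $\mu$ with $A\times B$ monochromatic. *)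

(* Defs.v *)
From mathcomp Require Import all_boot.
From mathcomp Require Import boolp classical_sets functions cardinality wochoice.

Set Implicit Arguments.
Unset Strict Implicit.
Unset Printing Implicit Defensive.

Local Open Scope classical_set_scope.
Local Open Scope card_scope.

(* Ordinals are represented by well-ordered types, two of them being equal as
   ordinals when they are order isomorphic ([wo_iso]); the elements of [alpha]
   play the role of the ordinals below [alpha]. *)
Record woType := WoType {
  carrier :> Type;
  wo_le : rel carrier;
  wo_leP : well_order wo_le }.

Definition wo_lt (alpha : woType) (x y : alpha) : bool := ~~ wo_le y x.

Definition wo_iso (alpha beta : woType) : Prop :=
  exists2 f : alpha -> beta,
    bijective f & forall x y, wo_le (f x) (f y) = wo_le x y.

Definition sub_le (alpha : woType) (A : set alpha) : rel (set_type A) :=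
  fun u v => wo_le (val u) (val v).

Lemma sub_leP (alpha : woType) (A : set alpha) : well_order (@sub_le alpha A).
Proof.
move=> C [u0 Cu0].
pose D : {pred alpha} := fun x => `[< exists2 u, u \in C & val u = x >].
have neD : wochoice.nonempty D by exists (val u0); apply/asboolP; exists u0.
have [_ [[/asboolP[u Cu <-] ulb] umin]] := wo_leP neD.
have DC v : v \in C -> val v \in D by move=> Cv; apply/asboolP; exists v.
exists u; split.
  by split=> // v Cv; exact: ulb (DC v Cv).
move=> v [Cv vlb]; apply/val_inj/umin; split; first exact: DC.
by move=> _ /asboolP[w Cw <-]; exact: vlb.
Qed.

Definition otp (alpha : woType) (A : set alpha) : woType :=
  WoType (@sub_leP alpha A).

Definition succ_le (alpha : woType) : rel (option alpha) :=
  fun u v => match u, v with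
  | Some x, Some y => wo_le x y
  | _, None => true
  | None, Some _ => false
  end.

Lemma succ_leP (alpha : woType) : well_order (@succ_le alpha).
Proof.
move=> C [u0 Cu0].
pose D : {pred alpha} := fun x => Some x \in C.
have [[x Dx]|nD] := pselect (exists x, x \in D).
  have [m [[Dm mlb] mmin]] := wo_leP (ex_intro _ x Dx : wochoice.nonempty D).
  exists (Some m); split.
    by split=> // -[y|//] Cy; exact: mlb.
  move=> [y|] [Cy ylb]; last by have := ylb _ Dm.
  by congr Some; apply: mmin; split=> // z Dz; exact: (ylb (Some z)).
have CN u : u \in C -> u = None.
  by case: u => // y Cy; case: nD; exists y.
exists None; split.
  by split=> [|v /CN -> //]; rewrite -(CN _ Cu0).
by move=> v [/CN ->].
Qed.

(* The ordinal [alpha + 1]; [None] is the new largest element. *)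
Definition wo_succ (alpha : woType) : woType := WoType (@succ_leP alpha).

Definition card_lt T U (A : set T) (B : set U) : bool :=
  (A #<= B) && (A #!= B).
Notation "A '#<' B" := (card_lt A B)
  (at level 79, format "A  '#<'  B") : card_scope.

(* Cardinals are the initial ordinals. *)
Definition is_cardinal (kappa : woType) : Prop :=
  forall x : kappa, [set y | wo_lt y x] #!= [set: kappa].

Definition is_card_succ (mu lambda : woType) : Prop :=
  [/\ is_cardinal lambda, [set: mu] #< [set: lambda] &
      forall nu : woType, is_cardinal nu -> [set: mu] #< [set: nu] ->
        [set: lambda] #<= [set: nu]].

Definition cofinal_set (alpha : woType) (A : set alpha) : Prop :=
  forall x, exists2 y, A y & wo_le x y.

Definition is_cf (alpha kappa : woType) : Prop :=
  [/\ is_cardinal kappa,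
      exists2 A : set alpha, cofinal_set A & A #= [set: kappa] &
      forall A : set alpha, cofinal_set A -> [set: kappa] #<= A].

Definition singular (mu : woType) : Prop :=
  [/\ is_cardinal mu, infinite_set [set: mu] &
      exists2 kappa, is_cf mu kappa & [set: kappa] #< [set: mu]].

(* [[set: set nu]] is the power set of [nu], of cardinality [2 ^ nu]. *)
Definition strong_limit (mu : woType) : Prop :=
  is_cardinal mu /\
  forall nu : woType, is_cardinal nu -> [set: nu] #< [set: mu] ->
    [set: set nu] #< [set: mu].

(* Main.v *)
(* Let [J] be the cofinality of [mu], [k : J -> mu] cofinal, and code the subsets
   of each [k j] by elements of [mu].  A set [E] of elements of [mu] then gives a
   sequence [x_E(j)], the code of the trace of [E] on [k j].  Write each [a] in
   [mu_plus] as an increasing union of small sets [below a i].  Call [x_E(j)] bad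
   for [(a, i)] if fewer than [i] codes at [j] have the same color as [x_E(j)]
   against every [b] in [below a i]: the number of bad codes is bounded
   independently of [j], so fewer than [mu] sets [E] have bad codes for [(a, i)]
   at cofinally many [j].  As [2 ^ mu > mu_plus], some [E] has, for all [(a, i)],
   eventually no bad code.  Fix it, and let [S] be a set of more than [mu] many
   [a] with the same row [h = (j |-> c (a, x_E(j)))], [t] a color taken by [h]
   cofinally often, and [a] in [S] such that for all [x < mu], [mu] many [b < a]
   in [S] agree with [a] on the columns below [x].  Then take cofinally many
   stages [x]: at each, choose many such [b], all in some [below a i], and then
   at some [j] far enough with [h j = t] many columns of the same type as
   [x_E(j)] over [below a i].  A column added at a stage is constant, equal to
   [t], on the rows added so far because it looks like [x_E(j)], and on the later
   rows because these look like [a]. *)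

Require Import Defs.
From mathcomp Require Import all_boot.
From mathcomp Require Import boolp classical_sets functions cardinality wochoice.

Local Open Scope classical_set_scope.
Local Open Scope card_scope.

Set Implicit Arguments.
Unset Strict Implicit.
Unset Printing Implicit Defensive.

(** * Well-ordered types *)

Lemma wo_min (alpha : woType) (P : alpha -> Prop) :
  (exists x, P x) -> exists2 m, P m & forall y, P y -> wo_le m y.
Proof.
move=> [x Px]; pose D : {pred alpha} := fun x => `[< P x >].
have neD : wochoice.nonempty D by exists x; apply/asboolP.
have [m [[/asboolP Pm mlb] _]] := wo_leP neD.
by exists m => // y Py; apply: mlb; apply/asboolP.
Qed.

Lemma wo_le_total (alpha : woType) (x y : alpha) : wo_le x y \/ wo_le y x.
Proof.
have [|m [->|->] lb] := @wo_min alpha (fun z => z = x \/ z = y).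
- by exists x; left.
- by left; apply: lb; right.
- by right; apply: lb; left.
Qed.

Lemma wo_le_refl (alpha : woType) (x : alpha) : wo_le x x.
Proof. by case: (wo_le_total x x). Qed.

(** Both points are minima of the pair they form, and minima in a well order are unique. *)
Lemma wo_le_anti (alpha : woType) (x y : alpha) :
  wo_le x y -> wo_le y x -> x = y.
Proof.
move=> xy yx; pose D : {pred alpha} := fun z => `[< z = x \/ z = y >].
have neD : wochoice.nonempty D by exists x; apply/asboolP; left.
have [m [_ mu]] := wo_leP neD.
rewrite -(mu x) ?(mu y) //; split.
- by apply/asboolP; right.
- by move=> z /asboolP[] -> //; exact: wo_le_refl.
- by apply/asboolP; left.
- by move=> z /asboolP[] -> //; exact: wo_le_refl.
Qed.

Lemma wo_le_trans (alpha : woType) (y x z : alpha) :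
  wo_le x y -> wo_le y z -> wo_le x z.
Proof.
move=> xy yz.
have [|m [->|[->|->]] lb] :=
    @wo_min alpha (fun w => w = x \/ w = y \/ w = z).
- by exists x; left.
- by apply: lb; right; right.
- by rewrite (wo_le_anti xy (lb _ _)) //; left.
- by rewrite -(wo_le_anti yz (lb _ _)) //; right; left.
Qed.

Lemma wo_ltW (alpha : woType) (x y : alpha) : wo_lt x y -> wo_le x y.
Proof. by rewrite /wo_lt; case: (wo_le_total x y) => // ->. Qed.

Lemma wo_ltxx (alpha : woType) (x : alpha) : ~ wo_lt x x.
Proof. by rewrite /wo_lt wo_le_refl. Qed.

Lemma wo_lt_neq (alpha : woType) (x y : alpha) : wo_lt x y -> x <> y.
Proof. by move=> xy exy; move: xy; rewrite exy => /wo_ltxx. Qed.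

Lemma wo_le_lt_trans (alpha : woType) (y x z : alpha) :
  wo_le x y -> wo_lt y z -> wo_lt x z.
Proof. by move=> xy; apply: contra => zx; exact: wo_le_trans zx xy. Qed.

Lemma wo_lt_le_trans (alpha : woType) (y x z : alpha) :
  wo_lt x y -> wo_le y z -> wo_lt x z.
Proof. by move=> xy yz; apply: contra xy; exact: wo_le_trans. Qed.

Lemma wo_lt_total (alpha : woType) (x y : alpha) :
  [\/ wo_lt x y, x = y | wo_lt y x].
Proof.
have [xy|yx] := boolP (wo_lt y x); first by constructor 3.
have [|yx'] := boolP (wo_lt x y); first by constructor 1.
by constructor 2; apply: wo_le_anti; [move: yx|move: yx']; rewrite negbK.
Qed.

Lemma wo_lt_wf (alpha : woType) : well_founded (@wo_lt alpha).
Proof.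
move=> x; apply: contrapT => nAx.
have [|m nAm mlb] := @wo_min alpha (fun x => ~ Acc (@wo_lt alpha) x).
  by exists x.
apply: nAm; constructor => y ym; apply: contrapT => /mlb.
exact/negP.
Qed.

(** The earlier values are passed to [step] as a total function, padded with [t0] off the segment,
    so that uses need no dependent types. *)
Lemma wo_rec (alpha : woType) T (t0 : T) (step : alpha -> (alpha -> T) -> T) :
  exists f : alpha -> T,
    forall x, f x = step x (fun y => if wo_lt y x then f y else t0).
Proof.
pose restr x (rec : forall y, wo_lt y x -> T) (y : alpha) : T :=
  if pselect (wo_lt y x) is left yx then rec y yx else t0.
exists (Fix (@wo_lt_wf alpha) (fun _ => T) (fun x rec => step x (restr x rec))).
move=> x; rewrite Fix_eq; last first.
  move=> {}x g g' gg'; congr step; apply/funext => y; rewrite /restr.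
  by case: pselect => // yx; rewrite gg'.
congr step; apply/funext => y; rewrite /restr.
by case: pselect => [yx|/negP/negbTE ->] //; rewrite yx.
Qed.

(** * Comparison of cardinalities by injections *)

Definition embeds T U : Prop := exists f : T -> U, injective f.

Notation seg x := {y | is_true (wo_lt y x)}.

Lemma embeds_to_seg (alpha : woType) (x : alpha) T (g : T -> alpha) :
  (forall t, wo_lt (g t) x) -> injective g -> embeds T (seg x).
Proof.
move=> gx gI; exists (fun t => exist (fun y => is_true (wo_lt y x)) (g t) (gx t)).
by move=> t t' [] /gI.
Qed.

Lemma embeds_seg_le (alpha : woType) (x y : alpha) :
  wo_le x y -> embeds (seg x) (seg y).
Proof.
move=> xy; apply: (embeds_to_seg (g := val)); last exact: val_inj.
by case=> z zx; exact: wo_lt_le_trans zx xy.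
Qed.

Lemma embeds_refl T : embeds T T.
Proof. by exists id. Qed.

Lemma embeds_trans U T V : embeds T U -> embeds U V -> embeds T V.
Proof. by move=> [f fI] [g gI]; exists (g \o f); exact: inj_comp. Qed.

Lemma onto_embeds T U (f : T -> U) : (forall u, exists t, f t = u) -> embeds U T.
Proof. by move=> /choice[g gK]; exists g; exact: can_inj gK. Qed.

Lemma embeds_setT T (A : set T) : embeds A T.
Proof. by exists val; exact: val_inj. Qed.

Lemma embeds_map T U (A : set T) (B : set U) (g : T -> U) :
  (forall x, A x -> B (g x)) ->
  (forall x y, A x -> A y -> g x = g y -> x = y) -> embeds A B.
Proof.
move=> AB gI.
exists (fun x : A => SigSub (mem_set (AB _ (set_mem (valP x)))) : B).
move=> x y /(congr1 val)/= gxy; apply: val_inj.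
by apply: gI gxy; exact: set_mem (valP _).
Qed.

Lemma embeds_subset T (A B : set T) : A `<=` B -> embeds A B.
Proof. by move=> AB; exact: (embeds_map (g := id)). Qed.

Lemma embeds_image T U (A : set T) (f : T -> U) : embeds (f @` A) A.
Proof.
apply: (@onto_embeds A _ (fun x : A => SigSub (mem_set (imageP f (set_mem (valP x))))
  : (f @` A : set U))).
move=> [u uA]; have [x Ax fx] := set_mem uA.
by exists (SigSub (mem_set Ax)); apply: val_inj.
Qed.

Lemma embeds_fibers T U I (f : T -> I) :
  (forall i, embeds [set t | f t = i] U) -> embeds T (I * U).
Proof.
move=> embT; pose g i := projT1 (cid (embT i)).
have gI i : injective (g i) := projT2 (cid (embT i)).
have fP t : t \in [set t' | f t' = f t] by exact/mem_set.
exists (fun t => (f t, g (f t) (SigSub (fP t)))) => t t' [].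
suff: forall i i' (p : t \in [set t0 | f t0 = i]) (p' : t' \in [set t0 | f t0 = i']),
  i = i' -> g i (SigSub p) = g i' (SigSub p') -> t = t' by exact.
by move=> i i' p p' ii'; subst i'; move=> /gI/(congr1 val).
Qed.

Lemma embeds_prod T U T' U' :
  embeds T T' -> embeds U U' -> embeds (T * U) (T' * U').
Proof.
move=> [f fI] [g gI]; exists (fun p => (f p.1, g p.2)).
by move=> [a b] [a' b'] /= [/fI -> /gI ->].
Qed.

Lemma embeds_option T U : embeds T U -> embeds (option T) (option U).
Proof.
move=> [f fI]; exists (omap f) => -[a|] [b|] //= [].
by move/fI ->.
Qed.

Lemma card_le_embeds T U (A : set T) (B : set U) : A #<= B <-> embeds A B.
Proof.
split=> [/card_leP[f]|[f fI]].
  by exists f => x y; apply: (inj (f := f)); rewrite inE.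
have fI' : set_inj [set: A] f by move=> x y _ _; exact: fI.
by apply/card_leP; apply/injfunPex; exists f.
Qed.

Lemma embeds_full T : embeds T [set: T].
Proof.
exists (fun t => SigSub (mem_set (I : [set: T] t))) => x y.
by move=> /(congr1 val).
Qed.

Lemma card_leT_embeds T U : [set: T] #<= [set: U] <-> embeds T U.
Proof.
rewrite card_le_embeds; split => TU.
  exact: embeds_trans (embeds_full T) (embeds_trans TU (embeds_setT _)).
exact: embeds_trans (embeds_setT _) (embeds_trans TU (embeds_full U)).
Qed.

Lemma card_lt_embeds T U (A : set T) (B : set U) :
  A #< B <-> embeds A B /\ ~ embeds B A.
Proof.
rewrite /card_lt -!card_le_embeds; split.
  by case/andP => AB; rewrite card_eq_le AB => /negP.
by move=> [AB BA]; rewrite AB card_eq_le AB; exact/negP.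
Qed.

Lemma card_ltT_embeds T U :
  [set: T] #< [set: U] <-> embeds T U /\ ~ embeds U T.
Proof. by rewrite card_lt_embeds -!card_le_embeds !card_leT_embeds. Qed.

Lemma cantor T : ~ embeds (set T) T.
Proof.
move=> [f fI]; pose D : set T := [set x | exists2 A, f A = x & ~ A x].
have nDD : ~ D (f D) by move=> DD; have [A /fI -> ] := DD.
by apply: (nDD); exists D.
Qed.

Lemma wo_exists T : exists alpha : woType, carrier alpha = T.
Proof.
have [R Rwo] := well_ordering_principle {classic T}.
by exists (WoType Rwo).
Qed.

(* Each value is the least element of [X] not yet used; if there were none, the
   previous values would exhaust [X]. *)
Lemma wo_embedding (alpha lambda : woType) (X : set lambda) :
  (forall x : alpha, ~ embeds X (seg x)) ->
  exists f : alpha -> lambda,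
    (forall x, X (f x)) /\ (forall x y, wo_lt x y -> wo_lt (f x) (f y)).
Proof.
move=> XN; have [a0|alpha0] := pselect (inhabited alpha); last first.
  exists (fun x => False_rect _ (alpha0 (inhabits x))).
  by split=> x; case: (alpha0 (inhabits x)).
case: a0 => a0.
have [l0 _] : exists l : lambda, True.
  apply: contrapT => l0; apply: (XN a0).
  by exists (fun u : X => False_rect _ (l0 (ex_intro _ (val u) I))) => u;
    case: l0; exists (val u).
pose fresh x (g : alpha -> lambda) m :=
  X m /\ forall y, wo_lt y x -> g y <> m.
have /choice[step stepP] (xg : alpha * (alpha -> lambda)) : exists m,
    (exists m', fresh xg.1 xg.2 m') ->
    fresh xg.1 xg.2 m /\ forall z, fresh xg.1 xg.2 z -> wo_le m z.
  have [/wo_min[m ? ?]|nex] := pselect (exists m, fresh xg.1 xg.2 m).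
    by exists m.
  by exists l0.
have [f fE] := wo_rec l0 (fun x g => step (x, g)).
have fP x : fresh x f (f x) /\ forall z, fresh x f z -> wo_le (f x) z.
  set g := fun y => if wo_lt y x then f y else l0.
  have fg m : fresh x g m <-> fresh x f m.
    by split=> -[Xm mN]; split=> // y yx; have := mN y yx; rewrite /g yx.
  have [] := stepP (x, g).
    apply: contrapT => nex; apply: (XN x).
    have Xf (u : X) : exists y : seg x, f (val y) = val u.
      apply: contrapT => nu; apply: nex; exists (val u); apply/fg.
      split; first exact: set_mem (valP u).
      by move=> y yx fy; apply: nu; exists (exist _ y yx).
    have [h hE] := choice Xf; exists h => u v huv.
    by apply: val_inj; rewrite -!hE huv.
  rewrite -[step _]fE => /fg fxP flb; split=> // z /fg; exact: flb.
exists f; split=> [x|x y xy]; first by have [[]] := fP x.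
have [[Xfy yN] _] := fP y; have [_ xlb] := fP x.
have le_xy : wo_le (f x) (f y).
  by apply: xlb; split=> // z zx; apply: yN; exact: wo_lt_le_trans zx (wo_ltW xy).
apply/negP => /(wo_le_anti le_xy); exact: yN.
Qed.

Lemma wo_increasing_inj (alpha lambda : woType) (f : alpha -> lambda) :
  (forall x y, wo_lt x y -> wo_lt (f x) (f y)) -> injective f.
Proof.
move=> fM x y fxy; have [/fM|//|/fM] := wo_lt_total x y;
  by rewrite fxy => /wo_ltxx.
Qed.

Lemma wo_embeds (alpha lambda : woType) :
  (forall x : alpha, ~ embeds lambda (seg x)) -> embeds alpha lambda.
Proof.
move=> aN; have [|f [_ fM]] := @wo_embedding alpha lambda setT.
  by move=> x /(embeds_trans (embeds_full _)); exact: aN.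
by exists f; exact: wo_increasing_inj.
Qed.

Lemma embeds_seg (alpha : woType) T :
  ~ embeds alpha T -> exists x : alpha, embeds T (seg x).
Proof.
have [lambda <-] := wo_exists T => aT; apply: contrapT => nx.
by apply: aT; apply: wo_embeds => x Tx; apply: nx; exists x.
Qed.

Lemma embeds_total T U : embeds T U \/ embeds U T.
Proof.
have [|TU] := pselect (embeds T U); first by left.
have [alpha aT] := wo_exists T; move: TU; rewrite -aT => TU; right.
have [x Ux] := embeds_seg TU; apply: embeds_trans Ux _.
by exists val; exact: val_inj.
Qed.

Lemma wo_fibered (T alpha : woType) (f : T -> alpha) :
  well_order (fun x y : T => wo_lt (f x) (f y) || `[< f x = f y >] && wo_le x y).
Proof.
move=> D [x0 Dx0].
have [|a [x Dx fx] alb] := @wo_min alpha (fun a => exists2 x, x \in D & f x = a).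
  by exists (f x0), x0.
have [|m [Dm fm] mlb] := @wo_min T (fun x => x \in D /\ f x = a).
  by exists x.
have mle y : y \in D -> wo_lt (f m) (f y) || `[< f m = f y >] && wo_le m y.
  move=> Dy; have [->//|fmy|fym] := wo_lt_total (f m) (f y).
    by apply/orP; right; rewrite mlb ?andbT; [exact/asboolP|rewrite -fmy].
  by move: fym; rewrite /wo_lt fm alb //; exists y.
exists m; split=> // y [Dy ylb].
have := mle y Dy; have := ylb m Dm.
case/orP => [ym|/andP[/asboolP fym ym]].
  case/orP => [/(wo_le_lt_trans (wo_ltW ym))/wo_ltxx//|/andP[/asboolP fmy _]].
  by move: ym; rewrite fmy => /wo_ltxx.
by rewrite fym => /orP[/wo_ltxx//|/andP[_ /wo_le_anti]]; exact.
Qed.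

(** Under the order of [wo_fibered], which compares values of [f] first, every proper segment lies
    in one of these level sets, so [wo_embeds] applies. *)
Lemma embeds_levels T (alpha lambda : woType) (f : T -> alpha) :
  (forall z, ~ embeds lambda [set t | wo_le (f t) z]) -> embeds T lambda.
Proof.
move=> fN; have [W WT] := wo_exists T; subst T.
change (embeds (WoType (wo_fibered f)) lambda); apply: wo_embeds => x lx.
apply: (fN (f x)); apply: embeds_trans lx _.
have sP (y : seg (x : WoType (wo_fibered f))) : val y \in [set t | wo_le (f t) (f x)].
  case: y => y /= yx; apply/mem_set => /=; move: yx; rewrite /wo_lt /=.
  by rewrite negb_or => /andP[]; rewrite negbK.
exists (fun y => SigSub (sP y)) => y z /(congr1 val)/=; exact: val_inj.
Qed.

(** Pairs are ordered by their maximum first, as in Gödel's pairing: the level sets then lie in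
    squares of closed segments. *)
Lemma embeds_square (lambda : woType) :
  (forall z : lambda,
     ~ embeds lambda ([set y | wo_le y z] * [set y | wo_le y z])) ->
  embeds (lambda * lambda) lambda.
Proof.
move=> lN.
pose m (p : lambda * lambda) := if wo_le p.1 p.2 then p.2 else p.1.
have m1 p : wo_le p.1 (m p).
  by rewrite /m; case: ifP => // _; exact: wo_le_refl.
have m2 p : wo_le p.2 (m p).
  rewrite /m; case: ifP => [_|/negbT]; [exact: wo_le_refl|exact: wo_ltW].
apply: (embeds_levels (f := m)) => z; apply: contra_not (lN z) => /embeds_trans; apply.
have s1 (p : [set t | wo_le (m t) z]) : (val p).1 \in [set y | wo_le y z].
  by apply/mem_set; apply: wo_le_trans (m1 _) (set_mem (valP p)).
have s2 (p : [set t | wo_le (m t) z]) : (val p).2 \in [set y | wo_le y z].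
  by apply/mem_set; apply: wo_le_trans (m2 _) (set_mem (valP p)).
exists (fun p => (SigSub (s1 p), SigSub (s2 p))) => p q [] e1 e2.
by apply: val_inj; rewrite [LHS]surjective_pairing e1 e2 -surjective_pairing.
Qed.

Lemma wo_iso_range (alpha beta : woType) (f : alpha -> beta) :
  (forall x y, wo_lt x y -> wo_lt (f x) (f y)) -> wo_iso (otp (range f)) alpha.
Proof.
move=> fM; have fI := wo_increasing_inj fM.
have gP (u : otp (range f)) : exists x, f x = val u.
  by have [x _ xu] := set_mem (valP u); exists x.
have [g gE] := choice gP; exists g.
  exists (fun x => SigSub (mem_set (imageT f x))) => [u|x].
    by apply: val_inj; rewrite /= gE.
  by apply: fI; rewrite gE.
move=> u v.
have -> : wo_le u v = wo_le (f (g u)) (f (g v)) by rewrite !gE.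
have [/[dup] uv /fM fuv|->|/[dup] vu /fM fvu] := wo_lt_total (g u) (g v).
- by rewrite !wo_ltW.
- by rewrite !wo_le_refl.
- by move: vu fvu; rewrite /wo_lt => /negbTE -> /negbTE ->.
Qed.

Lemma embeds_set T U : embeds T U -> embeds (set T) (set U).
Proof.
move=> [f fI]; exists (fun A => f @` A) => A B fAB.
apply/seteqP; split=> x Ax.
  have : (f @` B) (f x) by rewrite -fAB; exists x.
  by case=> y By /fI <-.
have : (f @` A) (f x) by rewrite fAB; exists x.
by case=> y By /fI <-.
Qed.

Lemma embeds_option_set T : embeds (option T) (set T).
Proof.
exists (fun o => if o is Some x then [set x] else set0) => -[x|] [y|] //.
- by move/seteqP => [/(_ x erefl) /= ->].
- by move/seteqP => [/(_ x erefl)].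
- by move/seteqP => [_ /(_ y erefl)].
Qed.

(** A variant of the Kuratowski pair, in which [None] tags the second component. *)
Lemma embeds_prod_set T : embeds (T * T) (set (set (option T))).
Proof.
exists (fun p => [set [set Some p.1]; [set Some p.2; None]]) => -[a b] [a' b'].
move=> /= /seteqP[sub _]; congr pair.
  have [] := sub [set Some a]; first by left.
    by move/seteqP => [/(_ _ erefl)[]].
  by move/seteqP => [_ /(_ None)]; apply: contraPP => _ /(_ (or_intror erefl)).
have [] := sub [set Some b; None]; first by right.
  by move/seteqP => [/(_ None (or_intror erefl))].
by move/seteqP => [/(_ (Some b) (or_introl erefl))] [[]|].
Qed.

Lemma embeds_fun_set T U : embeds (T -> U) (set (T * U)).
Proof.
exists (fun f => [set p | f p.1 = p.2]) => f g /seteqP[fg _].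
by apply/funext => x; rewrite (fg (x, f x)).
Qed.

Lemma cardinal_exists T :
  exists2 nu, is_cardinal nu & embeds T nu /\ embeds nu T.
Proof.
have [W WT] := wo_exists T.
(* The search runs in [wo_succ W] so that all of [W] is itself a segment, the one below [None]. *)
have [|x Tx xlb] := @wo_min (wo_succ W) (fun x => embeds T (seg x)).
  exists None; rewrite -WT.
  by apply: (@embeds_to_seg (wo_succ W) None W (@Some W)) => // y z [].
pose nu := otp [set y | wo_lt y x].
have Tnu : embeds T nu.
  apply: embeds_trans Tx _.
  exists (fun y => SigSub (mem_set (valP y : [set y | wo_lt y x] _))).
  by move=> y z /(congr1 val)/= /val_inj.
have segnu (u : nu) : ~ embeds T (seg u).
  move=> Tu; have := set_mem (valP u); apply/negP; rewrite negbK; apply: xlb.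
  apply: embeds_trans Tu _.
  apply: (embeds_to_seg (g := val \o val)); first by case.
  exact: inj_comp val_inj val_inj.
exists nu => [u|].
  apply/negP; rewrite card_eq_le => /andP[_ /card_le_embeds nu_u].
  apply: (segnu u).
  apply: embeds_trans Tnu _; apply: embeds_trans (embeds_full _) _.
  apply: embeds_trans nu_u _.
  apply: (embeds_to_seg (g := val)); last exact: val_inj.
  by move=> v; exact: set_mem (valP v).
split=> //; have [//|/embeds_seg[u]] := pselect (embeds nu T).
by move/segnu.
Qed.

(** * Cardinal arithmetic below a strong limit *)

Section StrongLimit.
Context (mu : woType).
Local Notation small T := (~ embeds mu T).
Hypothesis seg_small : forall x : mu, small (seg x).
Hypothesis set_small : forall T, small T -> small (set T).
Hypothesis mu_infinite : infinite_set [set: mu].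

Lemma small_embeds T U : embeds T U -> small U -> small T.
Proof. by move=> TU; apply: contra_not => muT; exact: embeds_trans TU. Qed.

(** If [x] were the maximum, sending each point to its set of predecessors would inject [mu] into
    the power set of [seg x], which is small. *)
Lemma wo_nomax (x : mu) : exists y, wo_lt x y.
Proof.
apply: contrapT => xmax; apply: (set_small (@seg_small x)).
exists (fun y => [set z | wo_lt (val z) y]) => y y' /seteqP[yy' y'y].
have le_x z : wo_le z x.
  by apply: contrapT => /negP xz; apply: xmax; exists z.
have [ylt|//|ylt] := wo_lt_total y y'.
  by have /wo_ltxx := y'y (exist _ y (wo_lt_le_trans ylt (le_x _))) ylt.
by have /wo_ltxx := yy' (exist _ y' (wo_lt_le_trans ylt (le_x _))) ylt.
Qed.

Lemma small_le (x : mu) : small [set y | wo_le y x].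
Proof.
have [y xy] := wo_nomax x; apply: small_embeds (@seg_small y).
apply: (embeds_to_seg (g := val)); last exact: val_inj.
by move=> z; exact: wo_le_lt_trans (set_mem (valP z)) xy.
Qed.

Lemma small_common T U : small T -> small U ->
  exists x : mu, embeds T (seg x) /\ embeds U (seg x).
Proof.
move=> /embeds_seg[x Tx] /embeds_seg[y Uy].
have [xy|yx] := wo_le_total x y; [exists y|exists x]; split=> //.
  exact: embeds_trans (embeds_seg_le xy).
exact: embeds_trans (embeds_seg_le yx).
Qed.

Lemma small_option T : small T -> small (option T).
Proof. by move=> /set_small; exact/small_embeds/embeds_option_set. Qed.

Lemma small_prod T U : small T -> small U -> small (T * U).
Proof.
move=> sT sU; have [x [Tx Ux]] := small_common sT sU.
apply: small_embeds (embeds_prod Tx Ux) _.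
apply: small_embeds (@embeds_prod_set _) _.
exact/set_small/set_small/small_option.
Qed.

Lemma small_fun T U : small T -> small U -> small (T -> U).
Proof.
move=> sT sU; apply: small_embeds (@embeds_fun_set _ _) _.
exact/set_small/small_prod.
Qed.

Lemma small_embeds_mu T : small T -> embeds T mu.
Proof. by case: (embeds_total T mu). Qed.

Lemma square_mu : embeds (mu * mu) mu.
Proof. by apply: embeds_square => z; apply: small_prod; exact: small_le. Qed.

Lemma option_mu : embeds (option mu) mu.
Proof.
have [a [b ab]] : exists a b : mu, a <> b.
  have [[a _]|] := pselect (exists a : mu, True); last first.
    move=> mu0; case: mu_infinite; suff -> : [set: mu] = set0 by [].
    by apply/seteqP; split=> x // _; case: mu0; exists x.
  by have [b /wo_lt_neq] := wo_nomax a; exists a, b.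
apply: embeds_trans square_mu.
exists (fun o => if o is Some x then (x, a) else (a, b)).
move=> [x|] [y|] // []; [by move=> ->|by move=> _ /ab|].
by move=> _ /esym/ab.
Qed.

(** A closed segment of [nu] has at most one point more than an open one, so its square still embeds
    in [mu], which [nu] does not. *)
Lemma square_mu_plus (nu : woType) : (forall z : nu, embeds (seg z) mu) ->
  ~ embeds nu mu -> embeds (nu * nu) nu.
Proof.
move=> segnu nuN; apply: embeds_square => z; apply: contra_not nuN.
move=> /embeds_trans; apply; apply: embeds_trans square_mu.
have le_mu : embeds [set y | wo_le y z] mu; last exact: embeds_prod.
apply: embeds_trans option_mu; apply: embeds_trans (embeds_option (segnu z)).
have [y|g gP] := @choice [set y | wo_le y z] (option (seg z))
    (fun y o => omap val o = if wo_lt (val y) z then Some (val y) else None).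
  have [yz|_] := boolP (wo_lt (val y) z); last by exists None.
  by exists (Some (exist (fun y => is_true (wo_lt y z)) _ yz)).
exists g => x y /(congr1 (omap val)); rewrite !gP.
have xz := set_mem (valP x); have yz := set_mem (valP y).
case: ifPn => [_|]; case: ifPn => [_|] //.
  by move=> [] /val_inj.
rewrite !negbK => zy zx _; apply: val_inj.
by rewrite (wo_le_anti xz zx) (wo_le_anti yz zy).
Qed.

End StrongLimit.

(** * The coloring *)

Section Polarized.
(** [nu] stands for the successor cardinal of [mu], and [J] for its cofinality. *)
Context (mu nu J theta : woType).
Local Notation small T := (~ embeds mu T).
Hypothesis seg_small : forall x : mu, small (seg x).
Hypothesis set_small : forall T, small T -> small (set T).
Hypothesis mu_infinite : infinite_set [set: mu].
Hypothesis nu_seg : forall z : nu, embeds (seg z) mu.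
Hypothesis nu_gt : ~ embeds nu mu.
Hypothesis pow_gt : ~ embeds (set mu) nu.
Hypothesis J_small : small J.
Hypothesis J_seg : forall j : J, ~ embeds J (seg j).
Hypothesis J_bounded : forall I (f : I -> mu), ~ embeds J I ->
  exists x, forall i, wo_le (f i) x.
Hypothesis theta_lt : ~ embeds J theta.
Context (k : J -> mu).
Hypothesis k_cofinal : forall x, exists j, wo_le x (k j).
Context (c : nu -> mu -> theta).

Lemma k_cofinal_lt x : exists j, wo_lt x (k j).
Proof.
have [y xy] := wo_nomax seg_small set_small x.
by have [j yj] := k_cofinal y; exists j; exact: wo_lt_le_trans yj.
Qed.

Lemma theta_small : small theta.
Proof.
by have [/theta_lt|tJ] := embeds_total J theta; [|exact: small_embeds tJ _].
Qed.

(** The power set of [seg (k j)] is small, hence fits below some [d j]. This bound later places all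
    columns coded at [j] below the subsequent stages. *)
Lemma coding_exists : exists (e : forall j, set (seg (k j)) -> mu) (d : J -> mu),
  (forall j, injective (e j)) /\ forall j p, wo_lt (e j p) (d j).
Proof.
have ex j : exists dj (f : set (seg (k j)) -> seg (dj : mu)), injective f.
  exact: embeds_seg (set_small (@seg_small (k j))).
have /choice[d dP] := ex.
pose f j := projT1 (cid (dP j)).
have fI j : injective (f j) := projT2 (cid (dP j)).
exists (fun j p => val (f j p)), d; split=> [j|j p]; last exact: valP (f j p).
by move=> p q /val_inj/fI.
Qed.

Lemma ranks_exist : exists r : nu -> nu -> mu, forall a b b',
  wo_lt b a -> wo_lt b' a -> r a b = r a b' -> b = b'.
Proof.
(* An empty [J] would embed in [theta]. The point only provides the default value [k j]. *)
have [j _] : exists j : J, True.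
  apply: contrapT => J0; apply: theta_lt.
  by exists (fun j => False_rect _ (J0 (ex_intro _ j I))) => j; case: J0; exists j.
have ra (a : nu) : exists r : nu -> mu, forall b b',
    wo_lt b a -> wo_lt b' a -> r b = r b' -> b = b'.
  have [f fI] := nu_seg a.
  have [b|r rE] := @choice nu mu (fun b m => forall ba : wo_lt b a,
      m = f (exist (fun b => is_true (wo_lt b a)) b ba)).
    have [ba|ba] := pselect (wo_lt b a); last by exists (k j).
    by eexists => ba'; rewrite (bool_irrelevance ba' ba).
  exists r => b b' ba b'a; rewrite (rE _ ba) (rE _ b'a) => /fI.
  by case.
by have /choice[r rP] := ra; exists r.
Qed.

(** * Codes, types and captured sets *)

Context (e : forall j, set (seg (k j)) -> mu) (d : J -> mu).
Hypothesis e_inj : forall j, injective (e (j := j)).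
Hypothesis e_lt : forall j p, wo_lt (e (j := j) p) (d j).
Context (r : nu -> nu -> mu).
Hypothesis r_inj : forall a b b',
  wo_lt b a -> wo_lt b' a -> r a b = r a b' -> b = b'.

(** For fixed [a] these sets increase with [i] and exhaust the predecessors of [a]. The point [a] is
    included so that columns of the same type also have the same color against [a]. *)
Definition below a i : set nu :=
  [set b | b = a \/ wo_lt b a /\ wo_le (r a b) i].

Lemma below_small a i : small (below a i).
Proof.
apply: small_embeds _ (small_option set_small (@small_le mu seg_small set_small i)).
have [b|g gP] := @choice (below a i) (option [set y | wo_le y i]) (fun b o =>
    val b = a /\ o = None \/ wo_lt (val b) a /\ omap val o = Some (r a (val b))).
  have [ba|[ba bi]] := set_mem (valP b); first by exists None; left.
  by exists (Some (SigSub (mem_set (bi : [set y | wo_le y i] _)))); right.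
exists g => b b' gbb'; apply: val_inj.
case: (gP b) (gP b'); rewrite gbb' => -[ba gb] [] [b'a gb'].
- by rewrite ba b'a.
- by move: gb'; rewrite gb.
- by move: gb; rewrite gb'.
- by move: gb; rewrite gb' => -[/esym]; exact: r_inj.
Qed.

Definition same_type a i (x y : mu) := forall b, below a i b -> c b x = c b y.

(* Fewer than [i] columns coded at [j] look like [e p] over [below a i]. *)
Definition bad a i j : set (set (seg (k j))) :=
  [set p | ~ embeds (seg i) [set q | same_type a i (e (j := j) q) (e p)]].

Arguments bad a i j _ : clear implicits.

(** A bad code is determined by its type and its position among the codes of that type, of which
    there are fewer than [i]. The bound does not mention [j]. *)
Lemma bad_embeds a i j :
  embeds (bad a i j) ((below a i -> theta) * seg i).
Proof.
apply: (embeds_fibers (f := fun p : bad a i j =>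
  fun b : below a i => c (val b) (e (val p)))) => phi.
set F := [set p | _].
(* Otherwise the class [F] receives [seg i], and none of its members could be bad. *)
have [//|iF] := embeds_total F (seg i).
have [[p Fp]|F0] := pselect (exists p, F p); last first.
  by exists (fun u : F => False_rect _ (F0 (ex_intro _ (val u) (set_mem (valP u)))))
    => u; case: F0; exists (val u); exact: set_mem (valP u).
case: (set_mem (valP p)); apply: embeds_trans iF _.
apply: (embeds_map (g := val)) => [q Fq b bb|q q' _ _]; last exact: val_inj.
pose b' : below a i := SigSub (mem_set bb).
by rewrite -[b]/(val b') [LHS](congr1 (fun h => h b') Fq) -Fp.
Qed.

Definition trace j (E : set mu) : set (seg (k j)) := fun y => E (val y).

Arguments trace j E _ : clear implicits.

Definition captured a i : set (set mu) :=
  [set E | forall x, exists2 j, wo_lt x (k j) & bad a i j (trace j E)].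

(* [E] is recovered from the traces in its capturing set, and each of these is
   coded by a bounded amount of information. *)
Lemma captured_small a i : small (captured a i).
Proof.
pose W := ((below a i -> theta) * seg i)%type.
have sW : small (J -> option W).
  apply: (small_fun seg_small set_small) => //; apply: (small_option set_small).
  apply: (small_prod seg_small set_small) => //.
  by apply: (small_fun seg_small set_small); [exact: below_small|exact: theta_small].
apply: small_embeds _ sW.
pose f j := projT1 (cid (bad_embeds a i j)).
have fI j : injective (f j) := projT2 (cid (bad_embeds a i j)).
pose F (E : captured a i) j : option W :=
  if pselect (bad a i j (trace j (val E))) is left h then
  Some (f j (SigSub (mem_set h))) else None.
have FP E E' x : F E = F E' -> val E x -> val E' x.
  move=> FEE' Ex; have [j xj badj] := set_mem (valP E) x.
  have := congr1 (fun h => h j) FEE'; rewrite /F.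
  case: pselect => // h; case: pselect => // h' [] /fI/(congr1 val)/= tE.
  pose xs := exist (fun y => is_true (wo_lt y (k j))) x xj.
  by have : trace j (val E) xs by []; rewrite tE.
exists F => E E' FEE'; apply: val_inj; apply/seteqP.
by split=> x; exact: FP.
Qed.

(** Otherwise the power set of [mu] is covered by captured sets indexed by [nu * mu], each embedding
    in [mu], so it embeds in [nu]. *)
Lemma uncaptured_exists : exists E, forall a i, ~ captured a i E.
Proof.
apply: contrapT => nE.
have /choice[f fP] : forall E, exists p, captured p.1 p.2 E.
  move=> E; apply: contrapT => ncap; apply: nE; exists E => a i cap.
  by apply: ncap; exists (a, i).
have mu_nu : embeds mu nu by case: (embeds_total nu mu).
have nu2 := square_mu_plus seg_small set_small mu_infinite nu_seg nu_gt.
apply: pow_gt.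
have /embeds_trans : embeds (set mu) ((nu * mu) * mu).
  apply: (embeds_fibers (f := f)) => p.
  apply: embeds_trans (small_embeds_mu (@captured_small p.1 p.2)).
  by apply: embeds_subset => E <-; exact: fP.
apply; apply: (embeds_trans _ nu2); apply: embeds_prod => //.
by apply: (embeds_trans _ nu2); apply: embeds_prod => //; exact: embeds_refl.
Qed.

(** * A generic row and sparse stages for a fixed uncaptured set *)

Context (E : set mu).
Hypothesis E_uncaptured : forall a i, ~ captured a i E.

Definition row a : J -> theta := fun j => c a (e (trace j E)).

(** There are fewer than [mu] functions from [J] to [theta], so [nu] cannot split into fibers of
    size at most [mu]. *)
Lemma common_row : exists h, ~ embeds [set a | row a = h] mu.
Proof.
apply: contrapT => nh; apply: nu_gt.
apply: embeds_trans (square_mu seg_small set_small).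
apply: (@embeds_trans ((J -> theta) * mu)).
  apply: (embeds_fibers (f := row)) => h.
  by apply: contrapT => hN; apply: nh; exists h.
apply: embeds_prod; last exact: embeds_refl.
by apply/small_embeds_mu/(small_fun seg_small set_small) => //; exact: theta_small.
Qed.

(** If the occurrences of each color were bounded, these fewer than cofinality many bounds would
    have a common bound, which some [k j] exceeds. *)
Lemma common_color (h : J -> theta) :
  exists t, forall x, exists2 j, wo_lt x (k j) & h j = t.
Proof.
apply: contrapT => nt.
have /choice[b bP] (t : theta) : exists x, forall j, h j = t -> ~ wo_lt x (k j).
  apply: contrapT => nx; apply: nt; exists t => x; apply: contrapT => nj.
  by apply: nx; exists x => j hj xj; apply: nj; exists j.
have [x bx] := J_bounded b theta_lt.
have [j xj] := k_cofinal_lt x.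
exact: bP (erefl (h j)) (wo_le_lt_trans (bx _) xj).
Qed.

Definition agree (S : set nu) a x : set nu :=
  [set b | [/\ wo_lt b a, S b & forall y, wo_lt y x -> c b y = c a y]].

(** If every [a] fails at some [x], split [S] by this [x] and then by the colors on [seg x]. There
    are at most [mu] classes, and each will be shown to embed in [mu]. *)
Lemma generic_exists (S : set nu) : ~ embeds S mu ->
  exists2 a, S a & forall x, embeds mu (agree S a x).
Proof.
move=> S_gt; apply: contrapT => na; apply: S_gt.
have /choice[f fP] (a : S) : exists x, small (agree S (val a) x).
  apply: contrapT => nx; apply: na; exists (val a); first exact: set_mem (valP a).
  by move=> x; apply: contrapT => xs; apply: nx; exists x.
apply: embeds_trans (square_mu seg_small set_small).
apply: (embeds_fibers (f := f)) => x; set Sx := [set a | _].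
apply: embeds_trans (square_mu seg_small set_small).
apply: (@embeds_trans ((seg x -> theta) * mu)); last first.
  apply: embeds_prod; last exact: embeds_refl.
  by apply/small_embeds_mu/(small_fun seg_small set_small) => //; exact: theta_small.
apply: (embeds_fibers (f := fun a : Sx => fun y : seg x => c (val (val a)) (val y))) => phi.
set Sp := [set a | _].
pose D : set nu := [set a | [/\ S a, small (agree S a x) &
  forall y : seg x, c a (val y) = phi y]].
apply: (@embeds_trans D).
  have DP (a : Sp) : D (val (val (val a))).
    have ax : f (val (val a)) = x := set_mem (valP (val a)).
    have ap := set_mem (valP a); split.
    - exact: set_mem (valP (val (val a))).
    - by rewrite -ax; exact: fP.
    - by move=> y; rewrite -ap.
  exists (fun a => SigSub (mem_set (DP a)) : D) => a a' /(congr1 val)/=.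
  by move/val_inj/val_inj/val_inj.
(* Earlier members of the class agree with [a] below [x], so every proper segment of the class is
   small. *)
apply: (@wo_embeds (otp D) mu) => a.
have [Sa a_small aphi] := set_mem (valP a); apply: small_embeds _ a_small.
have bP (b : seg a) : agree S (val a) x (val (val b)).
  have [Sb _ bphi] := set_mem (valP (val b)); split => //.
    exact: valP b.
  move=> y yx; pose ys := exist (fun y => is_true (wo_lt y x)) y yx.
  by rewrite (bphi ys) (aphi ys).
exists (fun b => SigSub (mem_set (bP b)) : agree S (val a) x).
by move=> b b' /(congr1 val)/= /val_inj/val_inj.
Qed.

(** Recursion along [J]: a proper segment of [J] is too short to be cofinal, so the bounds [y (f i)]
    from earlier stages have a common bound. *)
Lemma sparse_exists (y : mu -> mu) : exists f : J -> mu,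
  (forall j, wo_le (k j) (f j)) /\
  forall i j, wo_lt i j -> wo_le (y (f i)) (f j).
Proof.
have [j0|J0] := pselect (inhabited J); last first.
  exists k; split=> j; first exact: wo_le_refl.
  by case: J0; exists.
case: j0 => j0.
have /choice[step stepP] (jg : J * (J -> mu)) : exists x, wo_le (k jg.1) x /\
    forall i, wo_lt i jg.1 -> wo_le (y (jg.2 i)) x.
  have [x xP] := J_bounded (fun i : seg jg.1 => y (jg.2 (val i))) (@J_seg jg.1).
  have xP' i : wo_lt i jg.1 -> wo_le (y (jg.2 i)) x.
    by move=> ij; exact: (xP (exist (fun i => is_true (wo_lt i jg.1)) i ij)).
  have [kx|xk] := wo_le_total (k jg.1) x; first by exists x.
  exists (k jg.1); split=> [|i /xP' ix]; first exact: wo_le_refl.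
  exact: wo_le_trans xk.
have [f fE] := wo_rec (k j0) (fun j g => step (j, g)).
exists f; split=> [j|i j ij].
  by rewrite fE; have [] := stepP (j, fun i => if wo_lt i j then f i else k j0).
rewrite (fE j); have [_ /(_ i ij)] := stepP (j, fun i => if wo_lt i j then f i else k j0).
by rewrite /= ij.
Qed.

Lemma union_large (f : J -> mu) T (X : J -> set T) :
  (forall j, wo_le (k j) (f j)) -> (forall j, embeds (seg (f j)) (X j)) ->
  embeds mu [set x | exists j, X j x].
Proof.
move=> kf fX; apply: contrapT => sU.
(* If the union were small, its power set would fit below some [z]; the piece at a stage beyond [z]
   would then receive that power set, against Cantor. *)
have [z Uz] := embeds_seg (set_small sU); have [j zj] := k_cofinal z.
apply: (@cantor [set x | exists j, X j x]).
apply: embeds_trans Uz (embeds_trans (embeds_seg_le (wo_le_trans zj (kf j))) _).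
by apply: embeds_trans (fX j) _; apply: embeds_subset => x Xx; exists j.
Qed.

(** The pieces with rank at most [k j], for [j] in [J], cover the agreeing rows. If all embedded in
    [seg x], the whole would embed in the small set [J * seg x]. *)
Lemma agree_below (S : set nu) a x : embeds mu (agree S a x) ->
  exists2 i, wo_le x i & embeds (seg x) [set b | agree S a x b /\ wo_le (r a b) i].
Proof.
move=> G_large; apply: contrapT => ni.
have /choice[f fP] (b : agree S a x) : exists j, wo_le (r a (val b)) (k j).
  exact: k_cofinal.
have : small (J * seg x) by exact: small_prod.
apply; apply: embeds_trans G_large _; apply: (embeds_fibers (f := f)) => j.
set F := [set b | _].
have [//|xF] := embeds_total F (seg x); case: ni.
have [i xi ji] : exists2 i, wo_le x i & wo_le (k j) i.
  have [xj|jx] := wo_le_total x (k j).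
    by exists (k j) => //; exact: wo_le_refl.
  by exists x => //; exact: wo_le_refl.
exists i => //; apply: embeds_trans xF _.
apply: (embeds_map (g := val)) => [b Fb|b b' _ _]; last exact: val_inj.
split; first exact: set_mem (valP b).
by apply: wo_le_trans ji; rewrite -Fb; exact: fP.
Qed.

Lemma homogeneous_exists : exists (A : set nu) (B : set mu),
  [/\ wo_iso (otp A) (wo_succ mu), wo_iso (otp B) mu &
      exists t, forall a b, A a -> B b -> c a b = t].
Proof.
have [h h_large] := common_row; set S := [set a | row a = h] in h_large.
have [t t_cofinal] := common_color h.
have [a Sa a_generic] := generic_exists h_large.
have Srow b j : S b -> c b (e (trace j E)) = h j by move=> <-.
pose AA i x := [set b | agree S a x b /\ wo_le (r a b) i].
pose BB i j := [set m | exists2 q, m = e (j := j) q & same_type a i m (e (trace j E))].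
(* The data of stage [x] are a triple: the rank bound [i] of its rows, the index [j] of its columns,
   and a bound [y] for both [i] and [d j]. *)
have /choice[p pP] x : exists p : mu * J * mu,
    [/\ wo_le x p.1.1, embeds (seg x) (AA p.1.1 x), h p.1.2 = t,
        embeds (seg x) (BB p.1.1 p.1.2) & wo_le p.1.1 p.2 /\ wo_le (d p.1.2) p.2].
  have [i xi xA] := agree_below (a_generic x).
  (* As [E] is not captured by [a] and [i], its trace is bad only at boundedly many [k j]. *)
  have [z zP] : exists z, forall j, wo_lt z (k j) -> ~ bad a i j (trace j E).
    apply: contrapT => nz; apply: (@E_uncaptured a i) => z.
    apply: contrapT => nj; apply: nz; exists z => j zj badj.
    by apply: nj; exists j.
  have [j zj hj] := t_cofinal z.
  have [y [iy dy]] : exists y, wo_le i y /\ wo_le (d j) y.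
    have [|] := wo_le_total i (d j) => ?.
      by exists (d j); split=> //; exact: wo_le_refl.
    by exists i; split=> //; exact: wo_le_refl.
  exists (i, j, y); split=> //=.
  apply: embeds_trans (embeds_seg_le xi) _.
  have /contrapT/embeds_trans := zP j zj; apply.
  apply: (embeds_map (g := e (j := j))) => [q qE|q q' _ _].
    by exists q.
  exact: e_inj.
have [f [kf fy]] := sparse_exists (fun x => (p x).2).
pose X := [set b | exists j, AA (p (f j)).1.1 (f j) b].
pose Y := [set m | exists j, BB (p (f j)).1.1 (p (f j)).1.2 m].
have X_large : embeds mu X.
  by apply: (union_large kf) => j; case: (pP (f j)).
have Y_large : embeds mu Y.
  by apply: (union_large kf) => j; case: (pP (f j)).
have seg_lt T (Z : set T) (x : mu) : embeds mu Z -> ~ embeds Z (seg x).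
  by move=> muZ /(embeds_trans muZ); exact: seg_small.
(* Increasing copies of [mu] are taken inside [X] and [Y]; [F] then puts [a] on top of the rows. *)
have [g [gX gM]] := wo_embedding (fun x => seg_lt _ _ x X_large).
have [g' [gY g'M]] := wo_embedding (fun x => seg_lt _ _ x Y_large).
have Xlt b : X b -> wo_lt b a by move=> [j [[]]].
pose F (o : wo_succ mu) := if o is Some x then g x else a.
have FM o o' : wo_lt o o' -> wo_lt (F o) (F o').
  by case: o o' => [x|] [y|] //= xy; [exact: gM|exact: Xlt].
exists (range F), (range g'); split; [exact: wo_iso_range..|].
have cXY b m : b = a \/ X b -> Y m -> c b m = t.
  move=> bX [j Ym]; have [q mq mtype] := Ym.
  have [_ _ hj _ [iy dy]] := pP (f j).
  have same : S b -> below a (p (f j)).1.1 b -> c b m = t.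
    by move=> Sb /mtype ->; rewrite Srow.
  have cam : c a m = t.
    by rewrite mtype ?Srow //; left.
  case: bX => [->//|[j' [[ba Sb bagree] bi]]].
  (* If the row stage [j'] does not come after the column stage [j], its rank bound is the smaller
     one, so [b] lies in the set over which [m] has the type of the trace. *)
  have jj' : wo_le (p (f j')).1.1 (p (f j)).1.1 -> c b m = t.
    by move=> ij; apply: same => //; right; split=> //; exact: wo_le_trans ij.
  have [j'j|j'j|lt_jj'] := wo_lt_total j' j.
  - apply: jj'; have [_ _ _ _ [iy' _]] := pP (f j').
    have [xi _ _ _ _] := pP (f j).
    exact: wo_le_trans iy' (wo_le_trans (fy _ _ j'j) xi).
  - by apply: jj'; rewrite j'j; exact: wo_le_refl.
  (* The row came later: the column is below [d j], hence below [f j'], where [b] agrees with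
     [a]. *)
  - rewrite bagree // mq; apply: wo_lt_le_trans (e_lt q) _.
    exact: wo_le_trans dy (fy _ _ lt_jj').
exists t => _ _ [o _ <-] [m _ <-]; apply: cXY; last exact: gY.
by case: o => [x|]; [right; exact: gX|left].
Qed.

End Polarized.

(** * From the cardinal hypotheses to the combinatorial ones *)

Lemma strong_limit_set (mu : woType) T : strong_limit mu ->
  ~ embeds mu T -> ~ embeds mu (set T).
Proof.
move=> [_ mu_lim] sT; have [nu nu_card [Tnu nuT]] := cardinal_exists T.
have nu_mu : [set: nu] #< [set: mu].
  apply/card_ltT_embeds; split; last by move/embeds_trans/(_ nuT).
  by apply: embeds_trans nuT _; exact: small_embeds_mu.
have [_] := (card_ltT_embeds _ _).1 (mu_lim _ nu_card nu_mu).
by apply: contra_not => /embeds_trans; apply; exact: embeds_set.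
Qed.

Lemma cardinal_seg (mu : woType) (x : mu) : is_cardinal mu -> ~ embeds mu (seg x).
Proof.
move=> /(_ x)/negP mux; apply: contra_not mux => mu_x; rewrite card_eq_le card_leT /=.
apply/card_le_embeds; apply: embeds_trans (embeds_setT _) _.
apply: embeds_trans mu_x _.
exists (fun y => SigSub (mem_set (valP y : [set y | wo_lt y x] _))).
by move=> y z /(congr1 val)/= /val_inj.
Qed.

Theorem theorem1 (mu mu_plus cf_mu theta : woType)
    (mu_singular : singular mu)
    (mu_strong_limit : strong_limit mu)
    (mu_plusP : is_card_succ mu mu_plus)
    (pow_mu_gt : [set: mu_plus] #< [set: set mu])
    (cf_muP : is_cf mu cf_mu)
    (theta_card : is_cardinal theta)
    (theta_lt : [set: theta] #< [set: cf_mu])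
    (c : mu_plus * mu -> theta) :
  exists (A : set mu_plus) (B : set mu),
    [/\ wo_iso (otp A) (wo_succ mu),
        wo_iso (otp B) mu &
        exists t : theta, forall a b, A a -> B b -> c (a, b) = t].
Proof.
have [mu_card mu_inf [kappa [_ [D D_cof D_kappa] _] kappa_lt]] := mu_singular.
have [cf_card [C C_cof C_cf] cf_min] := cf_muP.
have [plus_card mu_lt_plus plus_min] := mu_plusP.
have seg_small (x : mu) : ~ embeds mu (seg x) := @cardinal_seg _ x mu_card.
have set_small T : ~ embeds mu T -> ~ embeds mu (set T).
  exact: strong_limit_set.
have [_ plus_gt] := (card_ltT_embeds _ _).1 mu_lt_plus.
have [_ pow_gt] := (card_ltT_embeds _ _).1 pow_mu_gt.
have [_ theta_cf] := (card_ltT_embeds _ _).1 theta_lt.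
(* A larger segment would have a cardinal above [mu], hence at least [mu_plus], although [mu_plus]
   is an initial ordinal. *)
have plus_seg (z : mu_plus) : embeds (seg z) mu.
  apply: contrapT => zmu.
  have [nu nu_card [znu nuz]] := cardinal_exists (seg z).
  apply: (cardinal_seg (x := z) plus_card).
  apply: embeds_trans nuz; apply/card_leT_embeds; apply: plus_min nu_card _.
  apply/card_ltT_embeds; split; last by move/(embeds_trans znu).
  by apply: embeds_trans znu; case: (embeds_total (seg z) mu).
(* The cofinal set [D] from singularity has size [kappa], below [mu], and bounds [cf_mu] by
   minimality. *)
have cf_small : ~ embeds mu cf_mu.
  have [_ mu_kappa] := (card_ltT_embeds _ _).1 kappa_lt.
  apply: contra_not mu_kappa => /embeds_trans; apply.
  apply/card_leT_embeds; apply: card_le_trans (cf_min _ D_cof) _.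
  by rewrite card_eq_le in D_kappa; case/andP: D_kappa.
have cf_bounded I (f : I -> mu) : ~ embeds cf_mu I ->
    exists x, forall i, wo_le (f i) x.
  move=> cfI; apply: contrapT => nx; apply: cfI.
  have /cf_min/card_le_embeds : cofinal_set (range f).
    move=> x; apply: contrapT => ny; apply: nx; exists x => i.
    have [//|ix] := boolP (wo_le (f i) x); case: ny; exists (f i) => //.
    exact: wo_ltW.
  move=> /(embeds_trans (embeds_full _))/embeds_trans; apply.
  exact: embeds_trans (embeds_image _ _) (embeds_setT _).
have [k k_cof] : exists k : cf_mu -> mu, forall x, exists j, wo_le x (k j).
  have [g gI] : embeds C cf_mu.
    apply: (embeds_trans _ (embeds_setT [set: cf_mu])); apply/card_le_embeds.
    by rewrite card_eq_le in C_cf; case/andP: C_cf.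
  have [m0 _] : exists m : mu, True.
    apply: contrapT => mu0; apply: mu_inf; suff -> : [set: mu] = set0 by [].
    by apply/seteqP; split=> x // _; case: mu0; exists x.
  (* [k] inverts the injection of the cofinal set [C] into [cf_mu], with value [m0] off its
     range. *)
  have [j|k kP] := @choice cf_mu mu (fun j m => forall u, g u = j -> m = val u).
    have [[u <-]|nu] := pselect (exists u, g u = j).
      by exists (val u) => v /gI ->.
    by exists m0 => u gu; case: nu; exists u.
  exists k => x; have [y Cy xy] := C_cof x.
  by exists (g (SigSub (mem_set Cy))); rewrite (kP _ _ erefl).
have cf_seg j : ~ embeds cf_mu (seg j) := @cardinal_seg _ j cf_card.
pose c' a b := c (a, b).
have [e [d [e_inj e_lt]]] := coding_exists seg_small set_small k.
have [r r_inj] := ranks_exist plus_seg theta_cf k.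
have [E EP] := uncaptured_exists seg_small set_small mu_inf plus_seg plus_gt
  pow_gt cf_small theta_cf c' e r_inj.
have [A [B [AP BP [t tP]]]] := homogeneous_exists seg_small set_small plus_gt
  cf_small cf_seg cf_bounded theta_cf k_cof e_inj e_lt EP.
by exists A, B; split => //; exists t => a b; exact: tP.
Qed.
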